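(* Let $\kappa$ be a cardinal and suppose there exists a family $\{N_\zeta:\zeta<\kappa\}$ of $\kappa$ pairwise almost disjoint subsets of $\mathfrak{c}$, each of cardinality $\mathfrak{c}$. Then the set $\mathcal{SZ}(\mathbb R)$ of Sierpi\'nski-Zygmund functions is strongly $\kappa$-algebrable in the algebra $\mathbb R^{\mathbb R}$.
   Context: $\mathfrak{c}$ denotes the cardinality of $\mathbb R$, identified with the first ordinal of that cardinality. Two subsets $A,B$ of $\mathfrak{c}$, each of cardinality $\mathfrak{c}$, are almost disjoint if $|A\cap B|<\mathfrak{c}$. A function $f:\mathbb R\to\mathbb R$ is a Sierpi\'nski-Zygmund function if for every set $Z\subset\mathbb R$ of cardinality $\mathfrak{c}$ the restriction $f|_Z$ is not a Borel map. $\mathbb R^{\mathbb R}$ is the commutative algebra of all functions $\mathbb R\to\mathbb R$ with pointwise operations. A subset $E$ of a commutative algebra $B$ is strongly $\kappa$-algebrable if there exists a $\kappa$-generated free algebra contained in $E\cup\{0\}$; equivalently, there is a set $X=\{x_\alpha:\alpha<\kappa\}\subset B$ (with $x_\alpha$ distinct) such that the set of all monomials $x_{\alpha_1}^{k_1}\cdots x_{\alpha_n}^{k_n}$ ($n\ge1$, distinct $\alpha_i$, $k_i\ge1$) is linearly independent and every nontrivial linear combination of such monomials lies in $E$ (i.e. for every nonzero polynomial $P$ without constant term and distinct $x_{\alpha_1},\dots,x_{\alpha_n}$, $P(x_{\alpha_1},\dots,x_{\alpha_n})$ is nonzero and belongs to $E$). *)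

(* Defs.v *)
(* MathComp-Analysis over Stdlib's concrete reals R
   (a realType via Rstruct), multivariate polynomials from multinomials
   (required without Import to avoid notation clashes with analysis; hence
   "P is a nonzero polynomial" is written as "some coefficient of P is
   nonzero", which is what P != 0 unfolds to). *)
From Stdlib Require Import Reals.
From HB Require Import structures.
From mathcomp Require Import all_boot all_order all_algebra.
From mathcomp Require Import all_classical all_reals all_analysis.
From mathcomp Require Import Rstruct Rstruct_topology.
From mathcomp Require mpoly.

Set Implicit Arguments.
Unset Strict Implicit.
Unset Printing Implicit Defensive.
Import Order.TTheory GRing.Theory Num.Theory.

Local Open Scope classical_set_scope.
Local Open Scope card_scope.
Local Open Scope ring_scope.

Definition Borel (Y : set R) : Prop :=
  smallest (sigma_algebra setT) [set U : set R | open U] Y.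

(* The restriction f|_Z : Z -> R is Borel, where Z carries the subspace
   topology; Borel sets of the subspace Z are the traces Z `&` B of Borel B. *)
Definition restr_borel (Z : set R) (f : R -> R) : Prop :=
  forall Y : set R, Borel Y ->
    exists B : set R, Borel B /\ Z `&` (f @^-1` Y) = Z `&` B.

Definition card_c (A : set R) : Prop := A #= [set: R].
(* |A| < c for A a set of reals (|A| <= c is automatic) *)
Definition card_lt_c (A : set R) : Prop := ~ ([set: R] #<= A).

Definition SZ (f : R -> R) : Prop :=
  forall Z : set R, card_c Z -> ~ restr_borel Z f.

Definition peval (n : nat) (P : mpoly.mpoly n R) (g : 'I_n -> R -> R)
  : R -> R := fun t => mpoly.meval (fun i => g i t) P.

Definition strongly_algebrable (K : Type) (E : (R -> R) -> Prop) : Prop :=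
  exists x : K -> R -> R,
    injective x /\
    forall (n : nat) (a : 'I_n -> K) (P : mpoly.mpoly n R),
      injective a ->
      (exists m, mpoly.mcoeff m P <> 0) -> mpoly.mcoeff (@mpoly.mnm0 n) P = 0 ->
      peval P (fun i => x (a i)) <> (fun _ => 0) /\
      E (peval P (fun i => x (a i))).

(* Main.v *)
Require Import Defs.
From Stdlib Require Import Reals Wellfounded.
From HB Require Import structures.
From mathcomp Require Import all_boot all_order all_algebra.
From mathcomp Require Import all_classical all_reals all_analysis.
From mathcomp Require Import Rstruct Rstruct_topology.
From mathcomp Require mpoly.
From mathcomp Require Import wochoice lra.
Import Order.TTheory GRing.Theory Num.Theory.
Local Open Scope classical_set_scope.
Local Open Scope card_scope.

(** Well-order [R] as the initial ordinal of the continuum and enumerate along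
    it a family [G r] of functions extending all Borel maps on sets of reals:
    such a map is determined by the Borel sets where it is below a rational, and
    there are only continuum many sequences of Borel sets.  At a point [t], the
    coefficients [c] and the values [- G r t] with [c, r] before [t] form a set
    [F t] smaller than the continuum.  Since an infinite set has as many finite
    sequences as elements, transfinite recursion yields reals [Y t u], indexed by
    all [u], algebraically independent over [F t].  With injections
    [nu z : R -> N z], the generators are [x z t = Y t (nu z t)].  For a
    polynomial [P] in finitely many of them, almost disjointness makes the
    indices [nu z t] distinct for all [t] outside a set smaller than the
    continuum, and then independence forbids [P (x t) = G r t]. *)

(** * Squares and finite sequences of infinite types *)

Lemma choice_on {T U : Type} (u0 : U) (A : set T) (P : T -> U -> Prop) :
  (forall x, A x -> exists y, P x y) -> exists f : T -> U, forall x, A x -> P x (f x).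
Proof.
move=> AP; have /choice[f fP] x : exists y, A x -> P x y.
  by have [/AP[y Pxy]|nAx] := pselect (A x); [exists y|exists u0].
by exists f.
Qed.

(** Comparability of cardinals by Zorn's lemma: a maximal graph of a partial injection exhausts [A]
    or [B], for otherwise a further pair could be added. [t0] and [u0] are only default values. *)
Lemma partial_injection_total {T U : Type} (t0 : T) (u0 : U)
    (A : set T) (B : set U) :
  (exists f : T -> U, (forall x, A x -> B (f x)) /\
     forall x y, A x -> A y -> f x = f y -> x = y) \/
  (exists g : U -> T, (forall y, B y -> A (g y)) /\
     forall x y, B x -> B y -> g x = g y -> x = y).
Proof.
pose P (G : set (T * U)) := (forall x y, G (x, y) -> A x /\ B y) /\
  (forall x y x' y', G (x, y) -> G (x', y') -> x = x' <-> y = y').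
have [F FP Ftot|G [[GAB Ginj] Gmax]] := @Zorn_bigcup _ P.
  split=> [x y [X FX Xxy]|x y x' y' [X FX Xxy] [Y FY Yxy]].
    by have [XAB _] := FP _ FX; exact: XAB.
  by have [XY|YX] := Ftot _ _ FX FY;
    [have [_] := FP _ FY|have [_] := FP _ FX]; apply=> //;
    [exact: XY|exact: YX].
have [domG|/existsNP[a]] := pselect (forall x, A x -> exists y, G (x, y)).
  left; have [f gP] := choice_on u0 _ _ domG; exists f.
  split=> [x /gP /GAB[]//|x y /gP Gx /gP Gy e].
  by apply/(Ginj _ _ _ _ Gx Gy).
move=> /not_implyP[Aa /forallNP Ga].
have [ranG|/existsNP[b]] := pselect (forall y, B y -> exists x, G (x, y)).
  right; have [f gP] := choice_on t0 _ (fun y x => G (x, y)) ranG; exists f.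
  split=> [y /gP /GAB[]//|x y /gP Gx /gP Gy e].
  by apply/(Ginj _ _ _ _ Gx Gy).
move=> /not_implyP[Bb /forallNP Gb].
exfalso; apply: (Gmax (G `|` [set (a, b)])).
  split; first by move=> x Gx; left.
  by move=> /(_ (a, b)) H; apply: (Ga b); apply: H; right.
split=> [x y [/GAB//|[-> ->]//]|x y x' y'].
move=> [Gx|[-> ->]] [Gx'|[-> ->]] //; first exact: Ginj.
- by split=> e; subst; [case: (Ga y)|case: (Gb x)].
- by split=> e; subst; [case: (Ga y')|case: (Gb x')].
Qed.

(* A partial pairing is a graph [G] of an injection from [B * B] to [B], where
   [B] is the set of points [b] such that [(b, b)] is in the domain. *)
Definition pairing_field {T : Type} (G : set (T * T * T)) : set T :=
  [set b | exists z, G (b, b, z)].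

Definition partial_pairing {T : Type} (G : set (T * T * T)) : Prop :=
  [/\ forall p z z', G (p, z) -> G (p, z') -> z = z',
      forall p p' z, G (p, z) -> G (p', z) -> p = p',
      forall a b z, G (a, b, z) ->
        [/\ pairing_field G a, pairing_field G b & pairing_field G z] &
      forall a b, pairing_field G a -> pairing_field G b ->
        exists z, G (a, b, z)].

(** Each clause has at most two triples as hypotheses, and two triples from a chain lie in a common
    member. *)
Lemma partial_pairing_bigcup {T : Type} (F : set (set (T * T * T))) :
  F `<=` partial_pairing -> total_on F subset ->
  partial_pairing (\bigcup_(X in F) X).
Proof.
move=> FP Ftot.
have join X Y : F X -> F Y -> exists Z, [/\ F Z, X `<=` Z & Y `<=` Z].
  by move=> FX FY; have [XY|YX] := Ftot _ _ FX FY; [exists Y|exists X]; split=> // ?.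
have sub X : F X -> pairing_field X `<=` pairing_field (\bigcup_(X in F) X).
  by move=> FX b [z Xb]; exists z, X.
split.
- move=> p z z' [X FX Xp] [Y FY Yp]; have [Z [FZ XZ YZ]] := join _ _ FX FY.
  by have [fZ _ _ _] := FP _ FZ; apply: fZ (XZ _ Xp) (YZ _ Yp).
- move=> p p' z [X FX Xp] [Y FY Yp]; have [Z [FZ XZ YZ]] := join _ _ FX FY.
  by have [_ iZ _ _] := FP _ FZ; apply: iZ (XZ _ Xp) (YZ _ Yp).
- move=> a b z [X FX Xp]; have [_ _ cX _] := FP _ FX.
  by have [? ? ?] := cX _ _ _ Xp; split; exact: (sub X).
- move=> a b [z [X FX Xa]] [z' [Y FY Yb]].
  have [Z [FZ XZ YZ]] := join _ _ FX FY; have [_ _ _ tZ] := FP _ FZ.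
  have [||w Zw] := tZ a b; first by exists z; exact: XZ.
    by exists z'; exact: YZ.
  by exists w, Z.
Qed.

(** Transporting a pairing of the naturals along [e] supplies the infinite starting point for Zorn's
    lemma. *)
Lemma partial_pairing_nat {T : Type} (e : nat -> T) : injective e ->
  exists G : set (T * T * T), partial_pairing G /\ forall n, pairing_field G (e n).
Proof.
move=> einj.
pose G := [set q : T * T * T | exists m n, q = (e m, e n, e (pickle (m, n)))].
have fG n : pairing_field G (e n) by exists (e (pickle (n, n))), n, n.
exists G; split=> //; split.
- move=> p z z' [m [n [-> ->]]] [m' [n' [/einj em /einj en ->]]].
  by rewrite em en.
- move=> p p' z [m [n [-> ->]]] [m' [n' [-> /einj]]].
  by move=> /(pcan_inj pickleK) [-> ->].
- by move=> a b z [m [n [-> -> ->]]].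
- move=> a b [z [m [? [-> _ _]]]] [z' [n [? [-> _ _]]]].
  by exists (e (pickle (m, n))), m, n.
Qed.

(** Here [g] gives a disjoint copy of the field [B]. Two slices of [f] embed the union [B'] back
    into [B]; pairs of [B'] not both in [B] go through this embedding and [f], then by [g] to fresh
    points. *)
Lemma partial_pairing_extend {T : Type} (G : set (T * T * T)) (f : T -> T -> T)
    (g : T -> T) (b0 b1 : T) : partial_pairing G ->
  (forall a b, pairing_field G a -> pairing_field G b -> G (a, b, f a b)) ->
  pairing_field G b0 -> pairing_field G b1 -> b0 <> b1 ->
  (forall b, pairing_field G b -> ~ pairing_field G (g b)) ->
  (forall a b, pairing_field G a -> pairing_field G b -> g a = g b -> a = b) ->
  exists G', partial_pairing G' /\ G `<` G'.
Proof.
move=> [fG iG cG tG] fP B0 B1 b01 gB ginj.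
set B := pairing_field G in fP B0 B1 gB ginj *.
have finj a b a' b' : B a -> B b -> B a' -> B b' -> f a b = f a' b' ->
    a = a' /\ b = b'.
  move=> Ba Bb Ba' Bb' e.
  have [] : (a, b) = (a', b') by apply: (iG _ _ (f a b)); [|rewrite e]; exact: fP.
  by [].
have fB a b : B a -> B b -> B (f a b).
  by move=> Ba Bb; have [] := cG _ _ _ (fP _ _ Ba Bb).
pose B' := B `|` g @` B.
have [e [eB einj]] : exists e : T -> T, (forall x, B' x -> B (e x)) /\
    forall x y, B' x -> B' y -> e x = e y -> x = y.
  have [|h hgB] := choice_on b0 (g @` B) (fun x b => B b /\ g b = x).
    by move=> _ [b Bb <-]; exists b.
  have hP b : B b -> h (g b) = b.
    by move=> Bb; have [|Bh] := hgB (g b); [exists b|apply: ginj].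
  exists (fun x => if `[< B x >] then f x b0 else f (h x) b1).
  have bB b : B b -> `[< B (g b) >] = false by move=> Bb; apply/asboolPn; exact: gB.
  split=> [x [Bx|[b Bb <-]]|x y].
  - by rewrite asboolT //; exact: fB.
  - by rewrite bB // hP //; exact: fB.
  move=> [Bx|[b Bb <-]] [By|[b' Bb' <-]]; rewrite ?bB // ?asboolT // ?hP //.
  + by move=> /finj[].
  + by move=> /finj[].
  + by move=> /finj[] // _ /esym.
  + by move=> /finj[] // ->.
pose N := [set q : T * T * T | [/\ B' q.1.1, B' q.1.2, ~ (B q.1.1 /\ B q.1.2) &
  q.2 = g (f (e q.1.1) (e q.1.2))]].
have NB' x y z : N (x, y, z) -> [/\ B' x, B' y & B' z].
  move=> [/= B'x B'y _ ->]; split=> //; right; exists (f (e x) (e y)) => //.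
  by apply: fB; exact: eB.
have NnB x y z : N (x, y, z) -> ~ B z.
  by move=> [/= B'x B'y _ ->]; apply: gB; apply: fB; exact: eB.
have B'tot x y : B' x -> B' y -> exists z, (G `|` N) (x, y, z).
  move=> B'x B'y; have [[Bx By]|nB] := pselect (B x /\ B y).
    by exists (f x y); left; exact: fP.
  by exists (g (f (e x) (e y))); right; split.
have fE : pairing_field (G `|` N) = B'.
  apply/seteqP; split=> [x [z [Gx|/NB'[]//]]|x B'x]; last exact: B'tot.
  by left; exists z.
exists (G `|` N); split; last first.
  split; first by move=> q Gq; left.
  have B'g : B' (g b0) by right; exists b0.
  have [z Nz] := B'tot _ _ B'g B'g.
  by move=> /(_ _ Nz) Gg; apply: (gB _ B0); exists z.
split=> [[x y] z z'|[x y] [x' y'] z|x y z|x y]; rewrite ?fE.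
- move=> [Gz|Nz] [Gz'|Nz']; first exact: fG Gz Gz'.
  + by have [/= _ _ []] := Nz'; have [] := cG _ _ _ Gz.
  + by have [/= _ _ []] := Nz; have [] := cG _ _ _ Gz'.
  + by have [/= _ _ _ ->] := Nz; have [/= _ _ _ ->] := Nz'.
- move=> [Gz|Nz] [Gz'|Nz']; first exact: iG Gz Gz'.
  + by case: (NnB _ _ _ Nz'); have [] := cG _ _ _ Gz.
  + by case: (NnB _ _ _ Nz); have [] := cG _ _ _ Gz'.
  + have [/= B'x B'y _ ez] := Nz; have [/= B'x' B'y' _ ez'] := Nz'.
    have [] : e x = e x' /\ e y = e y'.
      apply: finj; try exact: eB.
      by apply: ginj; [apply: fB; exact: eB..|rewrite -ez].
    by move=> /einj-> // /einj->.
- by move=> [/cG[? ? ?]|/NB'//]; split; left.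
- exact: B'tot.
Qed.

(** Hessenberg's theorem. If the field of a maximal pairing embedded into its complement, the
    pairing could be extended; so the complement embeds into the field, and two slices of [f] embed
    all of [T]. *)
Lemma pair_injection {T : Type} (e : nat -> T) : injective e ->
  exists f : T * T -> T, injective f.
Proof.
move=> einj; have [G0 [pG0 fG0]] := partial_pairing_nat _ einj.
(* The nonemptiness guard admits the empty graph, which is the union of the empty chain. *)
have [F FP Ftot|G [[pG G0ne] Gmax]] :=
    @Zorn_bigcup _ (fun G => partial_pairing G /\ (G !=set0 -> G0 `<=` G)).
  split; first by apply: partial_pairing_bigcup => // X /FP[].
  by move=> [q [X FX Xq]]; have [_ G0X] := FP _ FX;
    apply: subset_trans (bigcup_sup FX); apply: G0X; exists q.
have G0G : G0 `<=` G.
  apply: G0ne; apply: contrapT => /set0P/negP; rewrite negbK => /eqP G0'.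
  apply: (Gmax G0); last by split=> // _ ?.
  split; first by rewrite G0'.
  by move=> s; have [z /s] := fG0 0; rewrite G0'.
set B := pairing_field G.
have eB n : B (e n).
  by have [z G0z] := fG0 n; exists z; exact: G0G.
have e01 : e 0%N <> e 1%N by move/einj.
have [fG iG cG tG] := pG.
have [|f' fP'] := choice_on (e 0%N) (B `*` B) (fun p z => G (p, z)).
  by move=> [a b] [/= Ba Bb]; exact: tG.
pose f a b := f' (a, b).
have fP a b : B a -> B b -> G (a, b, f a b) by move=> Ba Bb; exact: fP'.
have finj a b a' b' : B a -> B b -> B a' -> B b' -> f a b = f a' b' ->
    a = a' /\ b = b'.
  move=> Ba Bb Ba' Bb' ee.
  have [] : (a, b) = (a', b') by apply: (iG _ _ (f a b)); [|rewrite ee]; exact: fP.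
  by [].
have fB a b : B a -> B b -> B (f a b).
  by move=> Ba Bb; have [] := cG _ _ _ (fP _ _ Ba Bb).
have [[g [gB ginj]]|[g [gB ginj]]] :=
    partial_injection_total (e 0%N) (e 0%N) B (~` B).
  have [G' [pG' GG']] := partial_pairing_extend _ _ _ _ _ pG fP (eB 0%N) (eB 1%N) e01 gB ginj.
  case: (Gmax _ GG'); split=> // _; exact: subset_trans G0G (properW GG').
pose h x := if `[< B x >] then f x (e 0%N) else f (g x) (e 1%N).
have hB x : B (h x).
  by rewrite /h; case: asboolP => Bx; apply: fB => //; exact: gB.
have hinj : injective h.
  move=> x y; rewrite /h; case: asboolP => Bx; case: asboolP => By.
  - by move=> /finj[].
  - by move=> /finj[]// ; exact: gB.
  - by move=> /finj[] => // [|_ /esym//]; exact: gB.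
  - by move=> /finj[] => //; [exact: gB..|move=> /ginj->].
exists (fun p => f (h p.1) (h p.2)) => -[x y] [x' y'] /= /finj[] //.
by move=> /hinj -> /hinj ->.
Qed.

(** The length is stored apart, since the fold alone need not separate sequences of different
    lengths. *)
Lemma seq_injection {T : Type} (e : nat -> T) : injective e ->
  exists f : seq T -> T, injective f.
Proof.
move=> einj; have [p pinj] := pair_injection _ einj.
pose c := foldr (fun x y => p (x, y)) (e 0%N).
exists (fun s => p (e (size s), c s)) => s t /pinj[/einj].
elim: s t => [|x s IH] [|y t] //= [st] /pinj[<- ct].
by rewrite (IH t).
Qed.

(** * Sets smaller than the continuum *)

(** Digits 0 and 1 in base 3 avoid the double expansions of base 2. *)
Definition ternary_sum {F : realType} (b : nat -> bool) (n : nat) : F :=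
  (\sum_(k < n) (b k)%:R / 3 ^+ k)%R.

Definition ternary_value {F : realType} (b : nat -> bool) : F :=
  sup (range (ternary_sum b)).

Lemma ternary_sumS {F : realType} (b : nat -> bool) n :
  (ternary_sum b n.+1 = ternary_sum b n + (b n)%:R / 3 ^+ n :> F)%R.
Proof. by rewrite /ternary_sum big_ord_recr. Qed.

(** Partial sums never decrease, and never increase once the full tail [3 / 2 / 3 ^+ n], with all
    later digits 1, is added. *)
Lemma ternary_sum_le {F : realType} (b : nat -> bool) m n :
  (ternary_sum b m <= ternary_sum b n + 3 / 2 / 3 ^+ n :> F)%R.
Proof.
have p3 k : (0 < (3 ^+ k : F)^-1)%R by rewrite invr_gt0 exprn_gt0.
have b01 k : (0 <= ((b k)%:R : F) <= 1)%R by case: (b k); rewrite /= ?lexx ler01.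
have mono d k : (ternary_sum b k <= ternary_sum b (k + d) :> F)%R.
  elim: d => [|d IH]; first by rewrite addn0.
  rewrite addnS ternary_sumS; apply: (le_trans IH).
  by rewrite lerDl divr_ge0 ?ler0n ?exprn_ge0.
have anti d k : (ternary_sum b (k + d) + 3 / 2 / 3 ^+ (k + d) <=
    ternary_sum b k + 3 / 2 / 3 ^+ k :> F)%R.
  elim: d => [|d IH]; first by rewrite addn0.
  apply: le_trans IH; rewrite addnS ternary_sumS exprS invfM.
  have := p3 (k + d)%N; have := b01 (k + d)%N.
  move: (3 ^+ (k + d))^-1%R => u /andP[b0 b1] u0; nra.
have [mn|nm] := leqP m n.
  apply: (le_trans (mono (n - m)%N m)); rewrite subnKC// lerDl.
  by have := p3 n; lra.
have := anti (m - n)%N n; rewrite subnKC ?(ltnW nm)//; have := p3 m; lra.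
Qed.

Lemma ternary_value_bounds {F : realType} (b : nat -> bool) n :
  (ternary_sum b n <= (ternary_value b : F) <= ternary_sum b n + 3 / 2 / 3 ^+ n)%R.
Proof.
apply/andP; split.
  apply: ub_le_sup; last by exists n.
  exists (ternary_sum b 0 + 3 / 2 / 3 ^+ 0)%R => _ [m _ <-].
  exact: ternary_sum_le.
apply: ge_sup; first by exists (ternary_sum b 0), 0%N.
by move=> _ [m _ <-]; exact: ternary_sum_le.
Qed.

(** At the first differing digit [n] one side gains [1 / 3 ^+ n], while all later digits contribute
    at most half of that. *)
Lemma ternary_value_inj {F : realType} : injective (@ternary_value F).
Proof.
suff lt n (b c : nat -> bool) : (forall k, (k < n)%N -> b k = c k) ->
    b n -> ~~ c n -> (ternary_value c < ternary_value b :> F)%R.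
  move=> b c bc; apply: contrapT => ne.
  have /ex_minnP[n bcn nmin] : exists n, b n != c n.
    by apply: contrapT => /forallNP e; apply: ne; apply/funext => n;
      apply/eqP; rewrite -[_ == _]negbK; exact/negP/e.
  have ebc k : (k < n)%N -> b k = c k.
    by move=> kn; apply/eqP; apply: contraTT kn => /nmin; rewrite -leqNgt.
  move: bcn; case bn: (b n); case cn: (c n) => // _.
    by have := lt n b c ebc bn (negbT cn); rewrite bc ltxx.
  have := lt n c b (fun k kn => esym (ebc k kn)) cn (negbT bn).
  by rewrite bc ltxx.
move=> ebc bn cn.
have /andP[lb _] := @ternary_value_bounds F b n.+1.
have /andP[_ ub] := @ternary_value_bounds F c n.+1.
have es : ternary_sum b n = ternary_sum c n :> F.
  by apply: eq_bigr => i _; rewrite ebc.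
rewrite ternary_sumS bn es in lb; rewrite ternary_sumS (negbTE cn) in ub.
have p3 : (0 < (3 ^+ n : F)^-1)%R by rewrite invr_gt0 exprn_gt0.
rewrite exprS invfM in ub; move: lb ub p3 => /=.
move: (3 ^+ n)^-1%R => u; lra.
Qed.

Lemma no_injection_into_nat (f : (nat -> bool) -> nat) : ~ injective f.
Proof.
move=> finj.
pose d n := `[< exists b, f b = n /\ b n = false >].
have [dd|dd] := boolP (d (f d)).
  by have /asboolP[b [/finj-> ]] := dd; rewrite dd.
by have /asboolPn := dd; apply; exists d; split=> //; exact: negbTE.
Qed.

Lemma setT_le_RP (A : set R) :
  [set: R] #<= A <-> exists f : R -> R, injective f /\ forall x, A (f x).
Proof.
split=> [/pcard_leP|[f [finj fA]]].
  rewrite injfunPex => -[f fA finj]; exists f.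
  by split=> [x y e|x]; [apply: finj; rewrite ?inE|exact: fA].
apply/pcard_leP; rewrite injfunPex; exists f => [x _|x y _ _ /finj//].
exact: fA.
Qed.

Lemma natr_inj : injective (fun n => (n%:R : R)%R).
Proof. by move=> m n /eqP; rewrite eqr_nat => /eqP. Qed.

Lemma card_lt_cS (A B : set R) : A `<=` B -> card_lt_c B -> card_lt_c A.
Proof.
move=> AB; apply: contra_not => /setT_le_RP[f [finj fA]].
by apply/setT_le_RP; exists f; split=> // x; exact: AB.
Qed.

(** View the copy of the continuum as a square: either some vertical line lies in [A], or every line
    meets [B], and one point from each gives a continuum in [B]. *)
Lemma card_lt_cU (A B : set R) :
  card_lt_c A -> card_lt_c B -> card_lt_c (A `|` B).
Proof.
move=> sA sB /setT_le_RP[f [finj fAB]].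
have [p pinj] := pair_injection _ natr_inj.
have pI x y x' y' : f (p (x, y)) = f (p (x', y')) -> x = x' /\ y = y'.
  by move=> /finj/pinj[].
have [[x xA]|/forallNP nA] := pselect (exists x, forall y, A (f (p (x, y)))).
  apply: sA; apply/setT_le_RP; exists (fun y => f (p (x, y))).
  by split=> // y y' /pI[].
apply: sB; have /choice[g gB] x : exists y, B (f (p (x, y))).
  by have /existsNP[y nAy] := nA x; exists y; have [] := fAB (p (x, y)).
apply/setT_le_RP; exists (fun x => f (p (x, g x))).
by split=> // x x' /pI[].
Qed.

Lemma card_lt_c_nat : card_lt_c (range (fun n => (n%:R : R)%R)).
Proof.
move=> /setT_le_RP[f [finj fA]].
have /choice[g gP] x : exists n, (n%:R)%R = f x by have [n _ <-] := fA x; exists n.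
apply: (no_injection_into_nat (g \o ternary_value)) => b c /= e.
by apply/(@ternary_value_inj R)/finj; rewrite -!gP e.
Qed.

Lemma card_lt_c1 (x : R) : card_lt_c [set x].
Proof.
move=> /setT_le_RP[f [finj fA]].
have /finj/eqP : f 0%R = f 1%R by rewrite (fA 0%R) (fA 1%R).
by rewrite eq_sym oner_eq0.
Qed.

Lemma card_lt_c0 : card_lt_c set0.
Proof. exact: card_lt_cS (card_lt_c1 0%R). Qed.

Lemma card_lt_c_bigcup_seq {I : eqType} (s : seq I) (A : I -> set R) :
  (forall i, i \in s -> card_lt_c (A i)) ->
  card_lt_c [set x | exists2 i, i \in s & A i x].
Proof.
elim: s => [|i s IH] sA; first by apply: card_lt_cS card_lt_c0 => x [].
apply: (@card_lt_cS _ (A i `|` [set x | exists2 i, i \in s & A i x])).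
  move=> x [j]; rewrite inE => /orP[/eqP->|js Aj]; first by left.
  by right; exists j.
apply: card_lt_cU; first by apply: sA; rewrite inE eqxx.
by apply: IH => j js; apply: sA; rewrite inE js orbT.
Qed.

(** * Well-orders of the reals *)

Lemma strict_well_order (T : eqType) : exists lt : T -> T -> Prop,
  [/\ well_founded lt, forall x y, [\/ lt x y, x = y | lt y x] &
      forall x y z, lt x y -> lt y z -> lt x z].
Proof.
have [r wr] := well_ordering_principle T.
have minP (A : set T) : A !=set0 ->
    exists z, A z /\ forall x, A x -> r z x.
  move=> [a Aa]; have [|z [[Az lz] _]] := wr [pred x | `[< A x >]].
    by exists a; apply/asboolP.
  exists z; split; first exact/asboolP.
  by move=> x Ax; apply: lz; exact/asboolP.
have wc : wo_chain r predT by move=> A _; exact: wr.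
have tot x y : r x y || r y x by exact: (wo_chainW wc).
have asym x y : r x y -> r y x -> x = y.
  by move=> xy yx; apply: (wo_chain_antisymmetric wc) => //; rewrite xy yx.
exists (fun x y => ~~ r y x); split.
- move=> x; apply: contrapT => nx.
  have [|z [nz zmin]] := minP [set x | ~ Acc (fun x y => ~~ r y x) x].
    by exists x.
  apply: nz; constructor => y ryz; apply: contrapT => /zmin.
  by rewrite (negbTE ryz).
- move=> x y; have [xy|] := boolP (r x y); last by constructor 3.
  have [yx|] := boolP (r y x); last by constructor 1.
  by constructor 2; exact: asym.
- move=> x y z /negP nyx /negP nzy; apply/negP => zx.
  (* Whichever of the three points is least, one of the assumptions fails. *)
  have [w [/= wxyz wmin]] := minP [set w | w \in [:: x; y; z]] (ex_intro _ x (mem_head _ _)).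
  have [wx wy wz] : [/\ r w x, r w y & r w z].
    by split; apply: wmin; rewrite /= !inE eqxx ?orbT.
  move: wxyz; rewrite !inE => /or3P[] /eqP e; subst w.
  + have := asym _ _ wz zx => e; subst z; exact: nzy.
  + exact: nyx.
  + exact: nzy.
Qed.

(* The order type is the initial ordinal of the cardinality of the continuum. *)
Lemma initial_well_order : exists lt : R -> R -> Prop,
  [/\ well_founded lt, forall x y, [\/ lt x y, x = y | lt y x],
      forall x y z, lt x y -> lt y z -> lt x z &
      forall c, card_lt_c [set x | lt x c]].
Proof.
have [lt [wf tri tr]] := strict_well_order R.
have [?|/existsNP[c0 nc0]] := pselect (forall c, card_lt_c [set x | lt x c]).
  by exists lt.
(* [c] is the least point whose segment has full size; pulled back along an injection [f] into that
   segment, the order has only small segments. *)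
have [c [/contrapT/setT_le_RP[f [finj fc]] cmin]] : exists c,
    ~ card_lt_c [set x | lt x c] /\ forall d, lt d c -> card_lt_c [set x | lt x d].
  elim/(well_founded_ind wf): c0 nc0 => c IH nc.
  have [?|/existsNP[d /not_implyP[dc nd]]] :=
      pselect (forall d, lt d c -> card_lt_c [set x | lt x d]).
    by exists c.
  exact: IH nd.
exists (fun x y => lt (f x) (f y)); split=> [|x y|x y z|d].
- exact: wf_inverse_image.
- by have [|/finj|] := tri (f x) (f y);
    [constructor 1|constructor 2|constructor 3].
- exact: tr.
- apply: contra_not (cmin _ (fc d)) => /setT_le_RP[g [ginj gd]].
  apply/setT_le_RP; exists (f \o g); split=> // x y /finj; exact: ginj.
Qed.

(** * Codes of Borel sets *)

(** The single operation [BNor], complement of a countable union, yields both complements and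
    countable unions. *)
Inductive borel_code :=
| BInterval of rat & rat
| BNor of (nat -> borel_code).

Fixpoint borel_set (c : borel_code) : set R :=
  match c with
  | BInterval p q => [set x | ratr p < x < ratr q]%R
  | BNor f => [set x | forall n, ~ borel_set (f n) x]
  end.

(* The labelled tree of a code, as a function of the branch. *)
Fixpoint borel_code_label (c : borel_code) (s : seq nat) : nat :=
  match c, s with
  | BInterval p q, _ => (pickle (p, q)).+1
  | BNor _, [::] => 0
  | BNor f, n :: s => borel_code_label (f n) s
  end.

(** Leaves carry positive labels and inner nodes 0, so the root label reveals the constructor. *)
Lemma borel_code_label_inj : injective borel_code_label.
Proof.
elim=> [p q|f IH] [p' q'|g] e.
- by have [/(pcan_inj pickleK)[-> ->]] := congr1 (@^~ [::]) e.
- by have := congr1 (@^~ [::]) e.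
- by have := congr1 (@^~ [::]) e.
- congr BNor; apply/funext => n; apply: IH; apply/funext => s.
  by have := congr1 (@^~ (n :: s)) e.
Qed.

(** The digits are the indicator of the graph of the label function. *)
Definition borel_code_real (c : borel_code) : R :=
  ternary_value (fun k =>
    if (unpickle k : option (seq nat * nat)) is Some sn
    then borel_code_label c sn.1 == sn.2 else false).

Lemma borel_code_real_inj : injective borel_code_real.
Proof.
move=> c d /ternary_value_inj e; apply: borel_code_label_inj; apply/funext => s.
have := congr1 (@^~ (pickle (s, borel_code_label d s))) e.
by rewrite /= pickleK /= eqxx => /eqP.
Qed.

Lemma borel_set_empty : borel_set (BInterval 0 0) = set0.
Proof.
apply/seteqP; split=> // x /andP[x0 /(lt_trans x0)].
by rewrite ltxx.
Qed.

Lemma open_borel_code (U : set R) : open U -> exists c, borel_set c = U.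
Proof.
move=> oU; pose I n := if (unpickle n : option (rat * rat)) is Some pq
  then BInterval pq.1 pq.2 else BInterval 0 0.
(* The outer constant [BNor] complements the inner one, giving the union of the rational intervals
   inside [U]. *)
exists (BNor (fun=> BNor (fun n =>
  if `[< borel_set (I n) `<=` U >] then I n else BInterval 0 0))).
apply/seteqP; split=> [x /= /(_ 0) H|x Ux /=].
  have /existsNP[n /contrapT] := H.
  by case: asboolP => [sU /sU//|_]; rewrite borel_set_empty.
move=> _; apply/existsNP.
have : nbhs x U by exact: open_nbhs_nbhs.
rewrite -nbhs_ballE => -[e /= e0 eU].
have [|p] := @rat_in_itvoo R (x - e)%R x; first by rewrite ltrBlDr ltrDl.
have [|q] := @rat_in_itvoo R x (x + e)%R; first by rewrite ltrDl.
rewrite !in_itv /= => /andP[xq qe] /andP[pe px].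
exists (pickle (p, q)); rewrite notK /I pickleK asboolT /= ?px//.
move=> y /andP[py yq]; apply: eU; rewrite /ball /= ltr_norml.
by apply/andP; split; lra.
Qed.

(** The coded sets form a sigma-algebra containing the open sets. *)
Lemma borel_code_surj (Y : set R) : Borel Y -> exists c, borel_set c = Y.
Proof.
move=> bY; suff [c _ cY] : range borel_set Y by exists c.
apply: bY; split; last by move=> U /open_borel_code[c <-]; exists c.
split=> [|_ [c _ <-]|A rA].
- by exists (BInterval 0 0) => //; exact: borel_set_empty.
- exists (BNor (fun=> c)) => //; apply/seteqP; split=> [x /= /(_ 0%N) //|x [_ /= nc] //].
- have /choice[c cA] n : exists c, borel_set c = A n.
    by have [c _ <-] := rA n; exists c.
  exists (BNor (fun=> BNor c)) => //; apply/seteqP; split=> x /=.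
    by move=> /(_ 0%N)/existsNP[n /contrapT]; rewrite cA; exists n.
  by move=> [n _ An] _ /(_ n); rewrite cA.
Qed.

Lemma Borel_lt (a : R) : Borel [set y | y < a]%R.
Proof. by move=> B [_ BU]; apply: BU; exact: open_lt. Qed.

(* A real codes a sequence of Borel sets [B_q], [q] rational, and the function
   coded sends [x] to the real [v] such that [B_q] contains [x] iff [v < q].
   It need not be Borel, but these functions extend all partial Borel ones. *)
Lemma borel_enumeration : exists G : R -> R -> R,
  forall (Z : set R) (f : R -> R), restr_borel Z f ->
    exists r, forall x, Z x -> f x = G r x.
Proof.
pose G r x := xget (0%R : R) [set v | exists2 c : nat -> borel_code,
  borel_code_real (BNor c) = r &
  forall q : rat, borel_set (c (pickle q)) x <-> (v < ratr q)%R].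
exists G => Z f bf.
have /choice[d dP] (q : rat) : exists c,
    Z `&` (f @^-1` [set y | y < ratr q]%R) = Z `&` borel_set c.
  have [B [/borel_code_surj[c <-] ->]] := bf _ (Borel_lt (ratr q)).
  by exists c.
have [c cE] : exists c : nat -> borel_code, forall q : rat, c (pickle q) = d q.
  exists (fun n => if unpickle n is Some q then d q else BInterval 0 0) => q.
  by rewrite pickleK.
have cP q x : Z x -> borel_set (c (pickle q)) x <-> (f x < ratr q)%R.
  move=> Zx; rewrite cE; split=> H; last by have [] : (Z `&` borel_set (d q)) x
    by rewrite -dP.
  by have [] : (Z `&` (f @^-1` [set y | y < ratr q]%R)) x by rewrite dP.
exists (borel_code_real (BNor c)) => x Zx; rewrite /G.
case: xgetP => [v -> [c' /borel_code_real_inj[->] vP]|/(_ (f x)) []]; last first.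
  by exists c => [//|q]; exact: cP.
(* Two reals lying below the same rationals coincide. *)
apply/eqP; rewrite eq_le !leNgt; apply/andP; split; apply/negP => /rat_in_itvoo[q];
  rewrite in_itv /= => /andP[lq ql].
  have /(cP _ _ Zx) fq : borel_set (c (pickle q)) x by apply/vP; exact: lq.
  by have := lt_trans ql fq; rewrite ltxx.
have /vP vq : borel_set (c (pickle q)) x by apply/(cP _ _ Zx); exact: lq.
by have := lt_trans ql vq; rewrite ltxx.
Qed.

(** * Algebraic independence *)

(** Adjoining the naturals makes [A] infinite while keeping it small; the pairs of a finite sequence
    and a natural number then embed into it, and each image point comes from such a pair. *)
Lemma card_lt_c_seq_image (f : seq R -> nat -> R) (A : set R) : card_lt_c A ->
  card_lt_c [set x | exists s k, {in s, forall a, A a} /\ x = f s k].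
Proof.
move=> sA; pose A' := A `|` range (fun n => n%:R : R)%R.
have {}sA : card_lt_c A' by apply: card_lt_cU => //; exact: card_lt_c_nat.
have [e einj] : exists e : nat -> {x | A' x}, injective e.
  by exists (fun n => exist _ (n%:R)%R (or_intror (imageT _ n))) => m n [] /natr_inj.
have [p pinj] := pair_injection _ einj; have [c cinj] := seq_injection _ einj.
apply: contra_not sA => /setT_le_RP[h [hinj hA]].
have /choice[g gP] x : exists sk : seq {x | A' x} * nat,
    h x = f (map sval sk.1) sk.2.
  have [s [k [sA ->]]] := hA x.
  pose l a := if pselect (A' a) is left Aa then exist _ a Aa else e 0%N.
  exists (map l s, k) => /=; rewrite -map_comp map_id_in // => a /sA Aa.
  by rewrite /l /=; case: pselect => // -[]; left.
apply/setT_le_RP; exists (fun x => sval (p (c (g x).1, e (g x).2))).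
split=> [x y /eq_sig_hprop_iff|x]; last exact: svalP.
move=> /(_ (fun _ => @Prop_irrelevance _)) /pinj[/cinj e1 /einj e2].
by apply: hinj; rewrite !gP e1 e2.
Qed.

Lemma card_lt_c_image (f : R -> R) (A : set R) :
  card_lt_c A -> card_lt_c (f @` A).
Proof.
move=> /(card_lt_c_seq_image (fun s _ => f (head 0%R s))).
apply: card_lt_cS => _ [a Aa <-]; exists [:: a], 0%N; split=> //.
by move=> b; rewrite inE => /eqP->.
Qed.

Lemma poly_roots_finite {F : fieldType} (p : {poly F}) : (p != 0)%R ->
  exists s : seq F, forall x, root p x -> x \in s.
Proof.
have [n] := ubnP (size p); elim: n p => // n IH p sp p0.
have [[a pa]|/forallNP np] := pselect (exists a, root p a); last first.
  by exists [::] => x /np.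
have /factor_theorem[q pq] := pa.
have q0 : (q != 0)%R by apply: contra_neq p0 => q0; rewrite pq q0 mul0r.
have [|s sP] := IH q _ q0.
  by move: sp; rewrite pq size_Mmonic ?monicXsubC// size_XsubC addn2.
exists (a :: s) => x; rewrite pq rootM root_XsubC inE => /orP[/sP->|->//].
by rewrite orbT.
Qed.

(** [sums (products A)] is the semiring generated by [A]; empty lists give 1 and 0. *)
Definition products (A : set R) : set R :=
  [set x | exists2 s, {in s, forall a, A a} & x = \prod_(a <- s) a]%R.

Definition sums (A : set R) : set R :=
  [set x | exists2 s, {in s, forall a, A a} & x = \sum_(a <- s) a]%R.

Definition roots_over (A : set R) : set R :=
  [set x | exists2 s, {in s, forall a, A a} &
    (Poly s != 0)%R /\ root (Poly s) x].

(** A root is named by a list of coefficients and its position in the finite list of roots. *)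
Lemma card_lt_c_roots_over (A : set R) :
  card_lt_c A -> card_lt_c (roots_over (sums (products A))).
Proof.
move=> sA.
have {}sA : card_lt_c (products A).
  apply: card_lt_cS (card_lt_c_seq_image (fun s _ => \prod_(a <- s) a)%R _ sA).
  by move=> _ [s As ->]; exists s, 0%N.
have {}sA : card_lt_c (sums (products A)).
  apply: card_lt_cS (card_lt_c_seq_image (fun s _ => \sum_(a <- s) a)%R _ sA).
  by move=> _ [s As ->]; exists s, 0%N.
have /choice[rts rtsP] (p : {poly R}) :
    exists s : seq R, (p != 0)%R -> forall x, root p x -> x \in s.
  have [->|/poly_roots_finite[s sP]] := eqVneq p 0%R; last by exists s.
  by exists [::]; move=> /eqP.
apply: card_lt_cS (card_lt_c_seq_image (fun s k => nth 0%R (rts (Poly s)) k) _ sA).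
move=> x [s As [s0 /(rtsP _ s0) xs]].
by exists s, (index x (rts (Poly s))); rewrite nth_index.
Qed.

(* A polynomial in [n] variables as a list of coefficients and exponents. *)
Definition sparse_term {n} (v : 'I_n -> R) (t : R * {ffun 'I_n -> nat}) : R :=
  (t.1 * \prod_i v i ^+ t.2 i)%R.

Definition sparse_eval {n} (v : 'I_n -> R) (l : seq (R * {ffun 'I_n -> nat})) : R :=
  (\sum_(t <- l) sparse_term v t)%R.

(** The coefficient of the [k]-th power of variable [i], with the other variables renumbered along
    [lift i]. *)
Definition sparse_coef {n} (i : 'I_n.+1) (k : nat)
    (l : seq (R * {ffun 'I_n.+1 -> nat})) : seq (R * {ffun 'I_n -> nat}) :=
  [seq (t.1, [ffun j => t.2 (lift i j)]) |
     t : R * {ffun 'I_n.+1 -> nat} <- [seq t <- l | (t.2 : {ffun _}) i == k]].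

Lemma sparse_eval_coef {n} (i : 'I_n.+1) (v : 'I_n.+1 -> R) (K : nat)
    (l : seq (R * {ffun 'I_n.+1 -> nat})) :
  (forall t, t \in l -> (t.2 i < K)%N) ->
  (sparse_eval v l =
    \sum_(k < K) sparse_eval (fun j => v (lift i j)) (sparse_coef i k l) * v i ^+ k)%R.
Proof.
move=> lK; rewrite /sparse_eval /sparse_coef.
under [RHS]eq_bigr do rewrite big_map big_filter mulr_suml.
rewrite (exchange_big_dep predT) //= big_seq [RHS]big_seq.
apply: eq_bigr => t tl; rewrite (big_pred1 (Ordinal (lK t tl))) => [|k] /=.
  rewrite /sparse_term -mulrA; congr (_ * _)%R; rewrite (bigD1_ord i) //= mulrC.
  by congr (_ * _)%R; apply: eq_bigr => j _; rewrite ffunE.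
by rewrite -val_eqE eq_sym.
Qed.

Lemma sums_sparse_eval {n} (A : set R) (v : 'I_n -> R)
    (l : seq (R * {ffun 'I_n -> nat})) :
  (forall i, A (v i)) -> (forall t, t \in l -> A t.1) ->
  sums (products A) (sparse_eval v l).
Proof.
move=> Av Al; exists (map (sparse_term v) l); last by rewrite big_map.
move=> _ /mapP[t tl ->].
exists (t.1 :: flatten [seq nseq (t.2 i) (v i) | i <- enum 'I_n]).
  move=> a; rewrite inE => /orP[/eqP->|/flattenP[_ /mapP[i _ ->]]]; first exact: Al.
  by move=> /nseqP[-> _].
rewrite big_cons big_flatten big_map big_enum /sparse_term; congr (_ * _)%R.
by apply: eq_bigr => i _; rewrite big_nseq iter_mulr_1.
Qed.

Lemma finite_max {T : Type} (lt : T -> T -> Prop) {n} (x : 'I_n.+1 -> T) :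
  (forall x y, [\/ lt x y, x = y | lt y x]) ->
  (forall x y z, lt x y -> lt y z -> lt x z) -> injective x ->
  exists i, forall j, j != i -> lt (x j) (x i).
Proof.
move=> tri tr xinj.
have [i iP] : exists i, forall j, j \in enum 'I_n.+1 -> j != i -> lt (x j) (x i).
  elim: (enum _) => [|k s [i IH]]; first by exists ord0.
  have [ki|/xinj ki|ik] := tri (x k) (x i).
  - by exists i => j; rewrite inE => /orP[/eqP->|/IH].
  - by exists i => j; rewrite inE ki => /orP[/eqP->|/IH//]; rewrite eqxx.
  - exists k => j; rewrite inE => /orP[/eqP->|js _]; first by rewrite eqxx.
    by have [->//|/(IH _ js) ji] := eqVneq j i; exact: tr ik.
by exists i => j; apply: iP; rewrite mem_enum.
Qed.

(** Algebraic independence in a stepwise form, suited to recursion along [lt] and to singling out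
    the last variable. *)
Definition independent_over (lt : R -> R -> Prop) (F : set R) (y : R -> R) :=
  forall u, ~ roots_over (sums (products (F `|` y @` [set t | lt t u]))) (y u).

(** Induction on the number of variables. In the variable with the [lt]-greatest index, the sum is a
    univariate polynomial over earlier values. Its coefficient at the exponent of [t] is nonzero by
    induction, so independence forbids a zero. *)
Lemma sparse_eval_neq0 (lt : R -> R -> Prop) (F : set R) (y : R -> R) :
  (forall x y, [\/ lt x y, x = y | lt y x]) ->
  (forall x y z, lt x y -> lt y z -> lt x z) ->
  independent_over lt F y ->
  forall n (u : 'I_n -> R) (l : seq (R * {ffun 'I_n -> nat})),
    injective u -> uniq (map snd l) -> (forall t, t \in l -> F t.1) ->
    (exists2 t, t \in l & t.1 != 0)%R ->
    (sparse_eval (fun i => y (u i)) l != 0)%R.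
Proof.
move=> tri tr yP; elim=> [|n IH] u l uinj lu Fl [t tl t0].
  (* Without variables there is only one exponent vector, and exponents do not repeat. *)
  have {}lu : l = [:: t].
    case: l lu tl {Fl} => [//|t1 [|t2 l]] /=; first by rewrite inE => _ /eqP->.
    rewrite inE negb_or => /andP[/andP[/eqP e _] _] _.
    by exfalso; apply: e; apply/ffunP => -[].
  by rewrite lu /sparse_eval big_seq1 /sparse_term big_ord0 mulr1.
have [i imax] := finite_max _ _ tri tr uinj.
pose K := (\max_(t <- l) t.2 i).+1.
have lK s : s \in l -> (s.2 i < K)%N.
  by move=> sl; rewrite ltnS; exact: leq_bigmax_seq.
pose A := F `|` y @` [set t | lt t (u i)].
pose w j := y (u (lift i j)).
pose s := [seq sparse_eval w (sparse_coef i k l) | k <- iota 0 K].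
have sE k : (k < K)%N -> ((Poly s)`_k = sparse_eval w (sparse_coef i k l))%R.
  by move=> kK; rewrite coef_Poly (nth_map 0%N) ?size_iota// nth_iota.
rewrite (sparse_eval_coef i _ K)//; apply: contra_notN (yP (u i)) => /eqP e.
exists s.
  move=> _ /mapP[k _ ->]; apply: sums_sparse_eval => [j|_ /mapP[r + ->]].
    by right; exists (u (lift i j)) => //; apply: imax; rewrite eq_sym neq_lift.
  by rewrite mem_filter => /andP[_ /Fl]; left.
split; last first.
  rewrite /root (@horner_coef_wide _ K); last first.
    by rewrite (leq_trans (size_Poly _))// size_map size_iota.
  by apply/eqP; rewrite -[RHS]e; apply: eq_bigr => k _; rewrite sE.
apply: contra_neq t0 => s0; apply/eqP; rewrite -[_ == _]negbK; apply/negP => t0.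
have := sE _ (lK _ tl); rewrite s0 coef0 => /esym/eqP; apply/negP.
apply: IH.
- by move=> j k /uinj /lift_inj.
(* Terms sharing the exponent at [i] stay distinct when it is dropped. *)
- rewrite -map_comp (eq_map (_ : _ =1 (fun m : {ffun 'I_n.+1 -> nat} =>
    [ffun j => m (lift i j)]) \o snd)) // map_comp map_inj_in_uniq.
    exact: subseq_uniq (map_subseq _ (filter_subseq _ _)) lu.
  move=> _ _ /mapP[r + ->] /mapP[r' + ->]; rewrite !mem_filter.
  move=> /andP[/eqP ri _] /andP[/eqP ri' _] /ffunP E; apply/ffunP => j.
  have [k ->|->] := unliftP i j; last by rewrite ri ri'.
  by have := E k; rewrite !ffunE.
- by move=> _ /mapP[r + ->]; rewrite mem_filter => /andP[_ /Fl].
- by exists (t.1, [ffun j => t.2 (lift i j)]); rewrite ?t0// map_f // mem_filter eqxx.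
Qed.

(** At stage [u], [F] and the earlier values form a small set, so the roots over it are few and a
    new value remains available. *)
Lemma independent_over_exists (lt : R -> R -> Prop) (F : set R) :
  well_founded lt -> (forall x y, [\/ lt x y, x = y | lt y x]) ->
  (forall c, card_lt_c [set x | lt x c]) -> card_lt_c F ->
  exists y : R -> R, injective y /\ independent_over lt F y.
Proof.
move=> wf tri seg sF.
(* Excluding [A] itself makes the values distinct. *)
pose excl A := A `|` roots_over (sums (products A)).
pose pick A := xget (0%R : R) (~` excl A).
pose step u (rec : forall t, lt t u -> R) :=
  pick (F `|` [set r | exists t (tu : lt t u), rec t tu = r]).
pose y := Fix wf (fun=> R) step.
have yE u : y u = pick (F `|` y @` [set t | lt t u]).
  rewrite /y Fix_eq => [|v f g fg].
    rewrite /step; congr (pick (F `|` _)); apply/seteqP; split=> r.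
      by move=> [t [tu <-]]; exists t.
    by move=> [t tu <-]; exists t, tu.
  rewrite /step; congr (pick (F `|` _)); apply/seteqP.
  by split=> r [t [tu <-]]; exists t, tu; rewrite fg.
have yP u : ~ excl (F `|` y @` [set t | lt t u]) (y u).
  rewrite [X in excl _ X]yE /pick; set A := F `|` _.
  have sA : card_lt_c A by apply: card_lt_cU => //; exact: card_lt_c_image.
  apply: (@xgetPex _ (0%R : R) (~` excl A)); apply: contrapT => /forallNP all.
  suff /card_lt_cS : [set: R] `<=` excl A.
    move=> /(_ (card_lt_cU _ _ sA (card_lt_c_roots_over _ sA))).
    by apply; exact: card_lexx.
  by move=> x _; apply: contrapT; exact: all.
exists y; split=> [u v uv|u]; last by move=> H; apply: (yP u); right.
have ne a b : lt a b -> y a <> y b.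
  by move=> ab e; apply: (yP b); left; right; exists a.
by have [/ne|//|/ne] := tri u v; rewrite uv.
Qed.

(** * Polynomials in the generators *)

Lemma SZ_neq0 (f : R -> R) : SZ f -> f <> (fun _ => 0%R).
Proof.
move=> szf f0; apply: (szf setT); first exact: card_eqxx.
move=> Y _; have [Y0|Y0] := pselect (Y 0%R).
  exists setT; split; first by move=> B [_ BU]; apply: BU; exact: openT.
  by congr (_ `&` _); apply/seteqP; split=> // x _; rewrite /= f0.
exists set0; split; first by move=> B [_ BU]; apply: BU; exact: open0.
by congr (_ `&` _); apply/seteqP; split=> // x; rewrite /= f0.
Qed.

Lemma card_c_ge (A : set R) : card_c A -> [set: R] #<= A.
Proof. by rewrite /card_c card_eq_sym => /card_eqPle[]. Qed.

(* Canonical instances of [mpoly] are inactive, since it is not imported. *)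
Local Canonical mpoly.mpoly_multinom__canonical__eqtype_Equality.

(** The polynomial [c + P]: taking [c] to be [- G r t] turns agreement of [P] with [G r] at [t] into
    the vanishing of a sparse sum. *)
Definition mpoly_terms {n} (c : R) (P : mpoly.mpoly n R) :
    seq (R * {ffun 'I_n -> nat}) :=
  (c, [ffun=> 0%N]) ::
  [seq (mpoly.mcoeff m P, [ffun i => mpoly.fun_of_multinom m i]) | m <- mpoly.msupp P].

Lemma mpoly_termsE {n} (c : R) (P : mpoly.mpoly n R) (v : 'I_n -> R) :
  (sparse_eval v (mpoly_terms c P) = c + mpoly.meval v P)%R.
Proof.
rewrite /sparse_eval big_cons big_map mpoly.mevalE; congr (_ + _)%R.
  rewrite /sparse_term /= big1 ?mulr1// => i _; by rewrite ffunE expr0.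
apply: eq_bigr => m _; rewrite /sparse_term /=; congr (_ * _)%R.
by apply: eq_bigr => i _; rewrite ffunE.
Qed.

(** As [P] has no constant term, the zero exponent of the added term does not recur. *)
Lemma uniq_mpoly_terms {n} (c : R) (P : mpoly.mpoly n R) :
  mpoly.mcoeff (@mpoly.mnm0 n) P = 0%R -> uniq (map snd (mpoly_terms c P)).
Proof.
move=> P0 /=; have finj : injective (fun m : mpoly.multinom n => [ffun i => mpoly.fun_of_multinom m i]).
  by move=> m m' /ffunP e; apply/mpoly.mnmP => i; have := e i; rewrite !ffunE.
rewrite -map_comp map_inj_uniq ?mpoly.msupp_uniq ?andbT//.
apply/negP => /mapP[m mP /= e].
have {}e : m = mpoly.mnm0.
  by apply: finj; rewrite -e; apply/ffunP => i; rewrite !ffunE mpoly.mnm0E.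
by move: mP; rewrite e mpoly.mcoeff_msupp P0 eqxx.
Qed.

Theorem theorem2p6 (K : Type) (N : K -> set R) :
  (forall z, card_c (N z)) ->
  (forall z w, z <> w -> card_lt_c (N z `&` N w)) ->
  strongly_algebrable K SZ.
Proof.
move=> cN adN.
have [lt [wf tri tr seg]] := initial_well_order.
have [G GP] := borel_enumeration.
have /choice[nu nuP] z : exists f : R -> R, injective f /\ forall x, N z (f x).
  exact/setT_le_RP/card_c_ge.
pose F a := [set c | lt c a] `|` (fun r => - G r a)%R @` [set r | lt r a].
have /choice[Y YP] a : exists y : R -> R, injective y /\ independent_over lt (F a) y.
  apply: independent_over_exists => //; apply: card_lt_cU => //.
  exact: card_lt_c_image.
(* Where [nu z] and [nu w] agree, their common value lies in both [N z] and [N w], and [nu z] is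
   injective. *)
have nu_neq z w : z <> w -> card_lt_c [set a | nu z a = nu w a].
  move=> /adN; apply: contra_not => /setT_le_RP[h [hinj hzw]].
  have [[zinj zN] [_ wN]] := (nuP z, nuP w).
  apply/setT_le_RP; exists (nu z \o h); split=> [u v /= /zinj/hinj//|u].
  by split; [exact: zN|rewrite /= hzw; exact: wN].
have nlt c : card_lt_c [set a | ~ lt c a].
  apply: card_lt_cS (card_lt_cU _ _ (seg c) (card_lt_c1 c)) => a /= nca.
  by have [|->|] := tri c a; [|right|left].
exists (fun z a => Y a (nu z a)); split.
  (* Equal generators would make [nu z] and [nu w] agree everywhere, since each [Y a] is
     injective. *)
  move=> z w zw; apply: contrapT => /nu_neq; apply; apply/setT_le_RP.
  exists id; split=> // a /=.
  have [Yinj _] := YP a; apply: Yinj.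
  exact: (congr1 (@^~ a) zw).
move=> n a P ainj [m Pm] P0.
suff szP : SZ (peval P (fun i t => Y t (nu (a i) t))).
  by split=> //; exact: SZ_neq0.
move=> Z /card_c_ge cZ /GP[r rP].
(* Outside [bad], [r] and the coefficients precede [t] and the indices are distinct. A finite union
   of small sets cannot contain [Z]. *)
pose bad := [set t | ~ lt r t] `|`
  ([set t | exists2 m, m \in mpoly.msupp P & ~ lt (mpoly.mcoeff m P) t] `|`
   [set t | exists2 ij : 'I_n * 'I_n, ij \in enum {: 'I_n * 'I_n} &
     ij.1 <> ij.2 /\ nu (a ij.1) t = nu (a ij.2) t]).
suff Zbad : Z `<=` bad.
  apply: (card_lt_cS _ _ Zbad) cZ; apply: card_lt_cU => //.
  apply: card_lt_cU; first by apply: card_lt_c_bigcup_seq => ? _; exact: nlt.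
  apply: card_lt_c_bigcup_seq => -[i j] _ /=.
  have [->|/eqP ij] := eqVneq i j; first by apply: card_lt_cS card_lt_c0 => t [].
  apply: (@card_lt_cS _ [set t | nu (a i) t = nu (a j) t]) => [t []//|].
  by apply: nu_neq => /ainj.
move=> t Zt; apply: contrapT => /not_orP[/contrapT rt /not_orP[mt ijt]].
have [_ Yt] := YP t.
have : (sparse_eval (fun i => Y t (nu (a i) t)) (mpoly_terms (- G r t) P) != 0)%R.
  apply: (sparse_eval_neq0 _ _ _ tri tr Yt n (fun i => nu (a i) t)).
  - move=> i j e; apply: contrapT => ij; apply: ijt; exists (i, j) => //.
    by rewrite mem_enum.
  - exact: uniq_mpoly_terms.
  - move=> s; rewrite inE => /orP[/eqP->|/mapP[m' m'P ->]] /=.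
      by right; exists r.
    by left; apply: contrapT => nl; apply: mt; exists m'.
  - exists (mpoly.mcoeff m P, [ffun i => mpoly.fun_of_multinom m i]); last exact/eqP.
    rewrite inE; apply/orP; right; apply/mapP; exists m => //.
    by rewrite mpoly.mcoeff_msupp; exact/eqP.
by rewrite mpoly_termsE -(rP _ Zt) addrC subrr eqxx.
Qed.
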